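(* There exists a computably enumerable set $A \subseteq \omega$ which is simultaneously $Q$-complete and $bd$-complete, but not $c$-complete.
   Context: $\omega$ is the set of natural numbers. $D_u$ denotes the finite set with canonical index $u$, and $W_e$ denotes the $e$-th computably enumerable (c.e.) set in a standard numbering. For sets $X, Y \subseteq \omega$: - $X \le_c Y$ ($c$-reducibility) if there is a (total) computable function $f$ such that for all $x$: $x \in X \iff D_{f(x)} \subseteq Y$. - $X \le_Q Y$ ($Q$-reducibility) if there is a computable function $f$ such that for all $x$: $x \in X \iff W_{f(x)} \subseteq Y$. - $X \le_{bd} Y$ (bounded disjunctive reducibility) if there are a computable function $f$ and $n \in \omega$ such that for all $x$: $x \in X \iff D_{f(x)} \cap Y \neq \varnothing$, and $|D_{f(x)}| < n$. For a reducibility $r$, a c.e. set $A$ is $r$-complete if $B \le_r A$ for every c.e. set $B$. *)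

(* Defs.v *)
From Stdlib Require Import Arith List Lia Cantor.

(** * Partial computable functions

    The one-argument partial recursive functions, built from zero, successor
    and the two projections of the Cantor pairing [Cantor.to_nat] by pairing,
    composition, primitive recursion and unbounded minimization.  Functions of
    several arguments are represented through the pairing. *)

Inductive code : Set :=
| CZero
| CSucc
| CFst
| CSnd
| CPair (c d : code)
| CComp (c d : code)
| CPrec (c d : code)
| CMin (c : code).

(** [eval c x y]: the function coded by [c] is defined at [x], with value [y].
    - [CPrec c d] is the [h] with [h (a, 0) = c a] and
      [h (a, n + 1) = d (a, (n, h (a, n)))];
    - [CMin c] maps [x] to the least [n] with [c (x, n) = 0], provided that
      [c (x, m)] is defined for all [m < n]. *)
Fixpoint eval (c : code) (x y : nat) {struct c} : Prop :=
  match c with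
  | CZero => y = 0
  | CSucc => y = S x
  | CFst => y = fst (of_nat x)
  | CSnd => y = snd (of_nat x)
  | CPair c d => exists u v, eval c x u /\ eval d x v /\ y = to_nat (u, v)
  | CComp c d => exists u, eval d x u /\ eval c u y
  | CPrec c d =>
      let a := fst (of_nat x) in
      (fix rec (n z : nat) {struct n} : Prop :=
         match n with
         | 0 => eval c a z
         | S n => exists w, rec n w /\ eval d (to_nat (a, to_nat (n, w))) z
         end) (snd (of_nat x)) y
  | CMin c =>
      eval c (to_nat (x, y)) 0 /\
      forall m, m < y -> exists v, eval c (to_nat (x, m)) (S v)
  end.

Definition computable (f : nat -> nat) : Prop :=
  exists c, forall x, eval c x (f x).

Lemma eval_functional c x y z : eval c x y -> eval c x z -> y = z.
Proof.
  revert x y z; induction c as [| | | |c IHc d IHd|c IHc d IHd|c IHc d IHd|c IHc];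
    simpl; intros x y z; try congruence.
  - intros (u & v & Hu & Hv & ->) (u' & v' & Hu' & Hv' & ->).
    now rewrite (IHc _ _ _ Hu Hu'), (IHd _ _ _ Hv Hv').
  - intros (u & Hu & Hy) (u' & Hu' & Hz).
    rewrite <- (IHd _ _ _ Hu Hu') in Hz; eauto.
  - revert y z; induction (snd (of_nat x)) as [|n IHn]; eauto.
    intros y z (w & Hw & Hy) (w' & Hw' & Hz).
    rewrite <- (IHn _ _ Hw Hw') in Hz; eauto.
  - intros [Hy Hlty] [Hz Hltz].
    destruct (Nat.lt_total y z) as [H|[H|H]]; auto.
    + destruct (Hltz _ H) as [v Hv]; discriminate (IHc _ _ _ Hy Hv).
    + destruct (Hlty _ H) as [v Hv]; discriminate (IHc _ _ _ Hz Hv).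
Qed.

(** * The standard numbering of the c.e. sets *)

(** A Gödel numbering: a bijection between codes and natural numbers. *)
Fixpoint encode (c : code) : nat :=
  match c with
  | CZero => 0
  | CSucc => 1
  | CFst => 2
  | CSnd => 3
  | CPair c d => 4 + 4 * to_nat (encode c, encode d)
  | CComp c d => 5 + 4 * to_nat (encode c, encode d)
  | CPrec c d => 6 + 4 * to_nat (encode c, encode d)
  | CMin c => 7 + 4 * encode c
  end.

Lemma encode_inj c d : encode c = encode d -> c = d.
Proof.
  revert d; induction c as [| | | |c1 IH1 c2 IH2|c1 IH1 c2 IH2|c1 IH1 c2 IH2|c IH];
    intros [| | | |d1 d2|d1 d2|d1 d2|d]; cbn [encode]; intros H; try lia; auto;
    try (f_equal; apply IH; lia);
    assert (E : to_nat (encode c1, encode c2) = to_nat (encode d1, encode d2)) by lia;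
    apply to_nat_inj in E; injection E as E1 E2; f_equal; auto.
Qed.

Lemma encode_surj e : exists c, encode c = e.
Proof.
  induction e as [e IH] using lt_wf_ind.
  destruct (le_lt_dec 4 e) as [He|He].
  - pose proof (Nat.div_mod_eq (e - 4) 4) as Hq.
    pose proof (Nat.mod_upper_bound (e - 4) 4 ltac:(lia)) as Hr.
    set (q := (e - 4) / 4) in *; set (r := (e - 4) mod 4) in *.
    pose proof (cancel_to_of q) as Hp.
    destruct (of_nat q) as [u v].
    pose proof (to_nat_non_decreasing u v) as Hle.
    destruct (IH u ltac:(lia)) as [c Hc]; destruct (IH v ltac:(lia)) as [d Hd].
    destruct (IH q ltac:(lia)) as [b Hb].
    destruct (Nat.eq_dec r 0); [exists (CPair c d)|
    destruct (Nat.eq_dec r 1); [exists (CComp c d)|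
    destruct (Nat.eq_dec r 2); [exists (CPrec c d)|exists (CMin b)]]];
    cbn [encode]; rewrite ?Hc, ?Hd, ?Hp, ?Hb; lia.
  - destruct e as [|[|[|[|]]]]; [exists CZero|exists CSucc|exists CFst|exists CSnd|lia];
      reflexivity.
Qed.

(** [W e] is the domain of the [e]-th partial computable function. *)
Definition W (e x : nat) : Prop :=
  exists c, encode c = e /\ exists y, eval c x y.

Definition ce (A : nat -> Prop) : Prop :=
  exists e, forall x, A x <-> W e x.

(** * Canonical indices of finite sets *)

(** [D u] lists, without repetition, the positions of the digits 1 in the
    binary expansion of [u], so that [u] is the sum of [2 ^ x] for [x] in
    [D u].  The bound [x < u] loses nothing, since [2 ^ x <= u] implies it. *)
Definition D (u : nat) : list nat := filter (Nat.testbit u) (seq 0 u).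

Lemma in_D u x : In x (D u) <-> Nat.testbit u x = true.
Proof.
  unfold D; rewrite filter_In, in_seq; split; [tauto|intros H; split; auto].
  destruct (le_lt_dec u x) as [Hx|Hx]; [|lia].
  assert (u < 2 ^ x) by (pose proof (Nat.pow_gt_lin_r 2 x ltac:(lia)); lia).
  rewrite Nat.testbit_eqb, Nat.div_small in H by lia; discriminate H.
Qed.

Lemma NoDup_D u : NoDup (D u).
Proof. apply NoDup_filter, seq_NoDup. Qed.

(** * Reducibilities *)

Definition le_c (X Y : nat -> Prop) : Prop :=
  exists f, computable f /\
    forall x, X x <-> (forall y, In y (D (f x)) -> Y y).

Definition le_Q (X Y : nat -> Prop) : Prop :=
  exists f, computable f /\
    forall x, X x <-> (forall y, W (f x) y -> Y y).

Definition le_bd (X Y : nat -> Prop) : Prop :=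
  exists f n, computable f /\
    forall x, (X x <-> exists y, In y (D (f x)) /\ Y y) /\
              length (D (f x)) < n.

Definition complete (r : (nat -> Prop) -> (nat -> Prop) -> Prop)
    (A : nat -> Prop) : Prop :=
  ce A /\ forall B, ce B -> r B A.

(* Main.v *)
(** Let [K] be a complete c.e. set and [K_s] its part enumerated before stage [s].
    The set [A] has two kinds of elements.

    - [⟨0, ⟨n, s⟩⟩] is in [A] if some [v < n] is in [K] but not in [K_s].  So [x] is in
      [K] if and only if [A] contains all [⟨0, ⟨x + 1, s⟩⟩] with [x] outside [K_s],
      whence Q-completeness.
    - When [x] enters [K], all [⟨i + 1, x⟩] are put into [A] except at most one.  So
      [x] is in [K] if and only if [A] contains [⟨1, x⟩] or [⟨2, x⟩], whence
      bd-completeness.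

    The exception is chosen to diagonalize: a c.e. set [B] is built that no
    computable [f] c-reduces to [A].  When [f z] is computed and [D (f z)] contains
    a number that can be kept out of [A], then [z] is put into [B].  Numbers of the
    second kind are kept out by a claim, and conflicts between claims are resolved
    by a finite injury priority.  Numbers of the first kind are kept out if [K_s] is
    correct below [n], which is guessed.  If [f] survives, numbers outside [B] must
    have in [D (f z)] some [⟨0, ⟨n, s⟩⟩] outside [A] with [n] arbitrarily large, and
    [K_s] is correct below [n]; then the complement of [K] would be c.e. *)

From Stdlib Require Import Arith List Lia Cantor Classical.
Require Import Defs.

Notation "⟨ x , y ⟩" := (to_nat (x, y)) (at level 0, format "⟨ x ,  y ⟩").
Notation π1 p := (fst (of_nat p)).
Notation π2 p := (snd (of_nat p)).
Notation bit u x := (Nat.testbit u x = true).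

#[local] Opaque to_nat of_nat.

Ltac unpair :=
  repeat (match goal with
          | |- context [of_nat (to_nat ?p)] => rewrite (cancel_of_to p)
          | H : context [of_nat (to_nat ?p)] |- _ => rewrite (cancel_of_to p) in H
          end; cbn [fst snd] in * ).

Lemma pair_eta p : ⟨π1 p, π2 p⟩ = p.
Proof. rewrite <- surjective_pairing. apply cancel_to_of. Qed.

Lemma pair_inj a b c d : ⟨a, b⟩ = ⟨c, d⟩ -> a = c /\ b = d.
Proof. intros H; apply to_nat_inj in H; now injection H. Qed.

Lemma pair_ge x y : x <= ⟨x, y⟩ /\ y <= ⟨x, y⟩.
Proof. pose proof (to_nat_non_decreasing x y); lia. Qed.

Lemma proj_le p : π1 p <= p /\ π2 p <= p.
Proof. pose proof (pair_ge (π1 p) (π2 p)) as H; now rewrite pair_eta in H. Qed.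

Lemma pair_le_mono x y z : y <= z -> ⟨x, y⟩ <= ⟨x, z⟩.
Proof.
  intros H; pose proof (to_nat_spec x y); pose proof (to_nat_spec x z); nia.
Qed.

Lemma bit_lt u x : bit u x -> x < u.
Proof.
  intros H; apply in_D in H; unfold D in H.
  apply filter_In in H as [H _]; apply in_seq in H; lia.
Qed.

(** * Computable functions *)

Lemma computable_ext f g :
  (forall x, f x = g x) -> computable f -> computable g.
Proof. intros E [c H]; exists c; intros x; rewrite <- E; auto. Qed.

Lemma computable_id : computable (fun x => x).
Proof.
  exists (CPair CFst CSnd); intros x; cbn [eval].
  exists (π1 x), (π2 x); rewrite pair_eta; auto.
Qed.

Lemma computable_comp f g :
  computable f -> computable g -> computable (fun x => f (g x)).
Proof. intros [c Hc] [d Hd]; exists (CComp c d); simpl; eauto. Qed.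

Lemma computable_S f : computable f -> computable (fun x => S (f x)).
Proof. apply (computable_comp S); now exists CSucc. Qed.

Lemma computable_pi1 f : computable f -> computable (fun x => π1 (f x)).
Proof. apply (computable_comp (fun x => π1 x)); now exists CFst. Qed.

Lemma computable_pi2 f : computable f -> computable (fun x => π2 (f x)).
Proof. apply (computable_comp (fun x => π2 x)); now exists CSnd. Qed.

Lemma computable_pair f g :
  computable f -> computable g -> computable (fun x => ⟨f x, g x⟩).
Proof.
  intros [c Hc] [d Hd]; exists (CPair c d); intros x; simpl.
  exists (f x), (g x); auto.
Qed.

Fixpoint const (n : nat) : code :=
  match n with 0 => CZero | S n => CComp CSucc (const n) end.

Lemma eval_const n x : eval (const n) x n.
Proof. induction n; simpl; eauto. Qed.

Lemma computable_const n : computable (fun _ => n).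
Proof. exists (const n); apply eval_const. Qed.

Fixpoint prec (a : nat) (g : nat -> nat -> nat) (n : nat) : nat :=
  match n with 0 => a | S n => g n (prec a g n) end.

(** [CPrec] passes to its step function the nested pair ⟨x, ⟨k, r⟩⟩, whence the form of the
    hypothesis on [g]. *)
Lemma computable_prec f g n :
  computable f -> computable (fun p => g (π1 p) (π1 (π2 p)) (π2 (π2 p))) ->
  computable n -> computable (fun x => prec (f x) (g x) (n x)).
Proof.
  intros [c Hc] [d Hd] Hn.
  pose (F p := prec (f (π1 p)) (g (π1 p)) (π2 p)).
  apply (computable_ext (fun x => F ⟨x, n x⟩)).
  { intros x; unfold F; unpair; reflexivity. }
  apply (computable_comp F (fun x => ⟨x, n x⟩));
    [|apply (computable_pair (fun x => x)); [apply computable_id|auto]].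
  exists (CPrec c d); intros p; unfold F; cbn [eval].
  induction (π2 p) as [|k IH]; simpl; auto.
  eexists; split; [apply IH|].
  specialize (Hd ⟨π1 p, ⟨k, prec (f (π1 p)) (g (π1 p)) k⟩⟩).
  now unpair.
Qed.

Ltac by_prec a g n :=
  apply (computable_ext (fun x => prec (a x) (g x) (n x)));
  [intros x; generalize (n x) | apply computable_prec].

Lemma computable_add f g :
  computable f -> computable g -> computable (fun x => f x + g x).
Proof.
  intros Hf Hg; by_prec f (fun (_ _ : nat) r => S r) g; auto.
  - intros k; induction k; simpl; lia.
  - apply computable_S, computable_pi2, computable_pi2, computable_id.
Qed.

Lemma computable_mul f g :
  computable f -> computable g -> computable (fun x => f x * g x).
Proof.
  intros Hf Hg; by_prec (fun _ : nat => 0) (fun x (_ : nat) r => r + f x) g; auto.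
  - intros k; induction k; simpl; lia.
  - apply computable_const.
  - apply computable_add.
    + apply computable_pi2, computable_pi2, computable_id.
    + apply (computable_comp f); [auto|apply computable_pi1, computable_id].
Qed.

Lemma computable_pow2 f : computable f -> computable (fun x => 2 ^ f x).
Proof.
  intros Hf; by_prec (fun _ : nat => 1) (fun (_ _ : nat) r => r + r) f; auto.
  - intros k; induction k; simpl; lia.
  - apply computable_const.
  - apply computable_add; apply computable_pi2, computable_pi2, computable_id.
Qed.

Lemma computable_pred f : computable f -> computable (fun x => pred (f x)).
Proof.
  intros Hf; by_prec (fun _ : nat => 0) (fun (_ k _ : nat) => k) f; auto.
  - intros k; destruct k; reflexivity.
  - apply computable_const.
  - apply computable_pi1, computable_pi2, computable_id.
Qed.

Lemma computable_sub f g :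
  computable f -> computable g -> computable (fun x => f x - g x).
Proof.
  intros Hf Hg; by_prec f (fun (_ _ : nat) r => pred r) g; auto.
  - intros k; induction k; simpl; lia.
  - apply computable_pred, computable_pi2, computable_pi2, computable_id.
Qed.

Ltac comp :=
  cbv beta;
  match goal with
  | |- computable (fun x => x) => apply computable_id
  | |- computable (fun _ => ?n) => apply (computable_const n)
  | |- computable (fun x => S (@?f x)) => apply (computable_S f); comp
  | |- computable (fun x => pred (@?f x)) => apply (computable_pred f); comp
  | |- computable (fun x => fst (of_nat (@?f x))) => apply (computable_pi1 f); comp
  | |- computable (fun x => snd (of_nat (@?f x))) => apply (computable_pi2 f); comp
  | |- computable (fun x => to_nat (@?f x, @?g x)) =>
      apply (computable_pair f g); comp
  | |- computable (fun x => @?f x + @?g x) => apply (computable_add f g); comp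
  | |- computable (fun x => @?f x * @?g x) => apply (computable_mul f g); comp
  | |- computable (fun x => @?f x - @?g x) => apply (computable_sub f g); comp
  | |- computable (fun x => 2 ^ (@?f x)) => apply (computable_pow2 f); comp
  | |- computable (fun x => ?F (@?f x)) => apply (computable_comp F f); [|comp]; auto
  | |- computable _ => auto
  end.

(** * Decidable predicates *)

Definition Dec (P : nat -> Prop) : Prop :=
  exists f, computable f /\ forall x, P x <-> f x = 0.

Lemma dec_ext P Q : (forall x, P x <-> Q x) -> Dec P -> Dec Q.
Proof. intros E (f & Hf & H); exists f; split; auto; intros x; now rewrite <- E. Qed.

Lemma dec_le f g : computable f -> computable g -> Dec (fun x => f x <= g x).
Proof. intros; exists (fun x => f x - g x); split; [comp|intros; lia]. Qed.

Lemma dec_eq f g : computable f -> computable g -> Dec (fun x => f x = g x).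
Proof.
  intros; exists (fun x => (f x - g x) + (g x - f x)); split; [comp|intros; lia].
Qed.

Lemma dec_and P Q : Dec P -> Dec Q -> Dec (fun x => P x /\ Q x).
Proof.
  intros (f & Hf & HP) (g & Hg & HQ); exists (fun x => f x + g x).
  split; [comp|intros x; rewrite HP, HQ; lia].
Qed.

Lemma dec_or P Q : Dec P -> Dec Q -> Dec (fun x => P x \/ Q x).
Proof.
  intros (f & Hf & HP) (g & Hg & HQ); exists (fun x => f x * g x).
  split; [comp|intros x; rewrite HP, HQ; nia].
Qed.

Lemma dec_not P : Dec P -> Dec (fun x => ~ P x).
Proof.
  intros (f & Hf & HP); exists (fun x => 1 - f x).
  split; [comp|intros x; rewrite HP; lia].
Qed.

Lemma dec_impl P Q : Dec P -> Dec Q -> Dec (fun x => P x -> Q x).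
Proof.
  intros (f & Hf & HP) (g & Hg & HQ); exists (fun x => (1 - f x) * g x).
  split; [comp|intros x; rewrite HP, HQ; nia].
Qed.

Lemma dec_ball P n :
  Dec (fun p => P (π1 p) (π2 p)) -> computable n ->
  Dec (fun x => forall y, y < n x -> P x y).
Proof.
  intros (f & Hf & HP) Hn.
  (* A sum vanishes exactly when all its terms do. *)
  exists (fun x => prec 0 (fun k r => f ⟨x, k⟩ + r) (n x)); split.
  - apply (computable_prec (fun _ => 0) (fun x k r => f ⟨x, k⟩ + r)); comp.
  - intros x; induction (n x) as [|k IH]; simpl; [split; auto; lia|].
    specialize (HP ⟨x, k⟩); unpair; split.
    + intros H. rewrite (proj1 HP), (proj1 IH); auto.
    + intros H y Hy.
      destruct (Nat.eq_dec y k) as [->|]; [apply HP; lia|apply IH; lia].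
Qed.

Lemma dec_bex P n :
  Dec (fun p => P (π1 p) (π2 p)) -> computable n ->
  Dec (fun x => exists y, y < n x /\ P x y).
Proof.
  intros HP Hn.
  apply (dec_ext (fun x => ~ forall y, y < n x -> ~ P x y)).
  - intros x; split.
    + intros H; apply NNPP; intros H'; apply H; intros y Hy Py; eauto.
    + intros (y & Hy & Py) H; exact (H y Hy Py).
  - apply dec_not, (dec_ball (fun x y => ~ P x y)); auto; now apply dec_not.
Qed.

(** The witness [q] is bounded so that the right-hand side is visibly decidable. *)
Lemma bit_spec a n :
  bit a n <-> exists q, q < S a /\ exists r, r < 2 ^ n /\ a = (2 * q + 1) * 2 ^ n + r.
Proof.
  assert (0 < 2 ^ n) by (apply Nat.neq_0_lt_0, Nat.pow_nonzero; lia).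
  split.
  - intros H0; apply Nat.testbit_true in H0.
    pose proof (Nat.div_mod_eq a (2 ^ n)) as H1.
    pose proof (Nat.div_mod_eq (a / 2 ^ n) 2) as H2.
    pose proof (Nat.mod_upper_bound a (2 ^ n) ltac:(lia)) as H3.
    exists (a / 2 ^ n / 2); split; [nia|].
    exists (a mod 2 ^ n); split; [lia|]. rewrite H0 in H2. nia.
  - intros (q & _ & r & Hr & ->). apply Nat.testbit_true.
    rewrite Nat.div_add_l, (Nat.div_small r), Nat.add_0_r by lia.
    now rewrite Nat.add_comm, Nat.mul_comm, Nat.Div0.mod_add by lia.
Qed.

Ltac dec_with tac :=
  cbv beta;
  match goal with
  | |- Dec (fun x => _ /\ _) => apply dec_and; dec_with tac
  | |- Dec (fun x => _ \/ _) => apply dec_or; dec_with tac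
  | |- Dec (fun x => ~ _) => apply dec_not; dec_with tac
  | |- Dec (fun x => exists y, y < @?n x /\ @?P x y) =>
      apply (dec_bex P n); [dec_with tac|comp]
  | |- Dec (fun x => forall y, y < @?n x -> @?P x y) =>
      apply (dec_ball P n); [dec_with tac|comp]
  | |- Dec (fun x => (@?f x) < (@?g x)) =>
      apply (dec_le (fun x => S (f x)) g); comp
  | |- Dec (fun x => (@?f x) <= (@?g x)) => apply (dec_le f g); comp
  | |- Dec (fun x => @eq nat (@?f x) (@?g x)) => apply (dec_eq f g); comp
  | |- Dec (fun x => @?P x -> @?Q x) => apply (dec_impl P Q); dec_with tac
  | |- _ => tac
  end.

Lemma dec_bit f g : computable f -> computable g -> Dec (fun x => bit (f x) (g x)).
Proof.
  intros Hf Hg; eapply dec_ext; [intros x; symmetry; apply bit_spec|].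
  dec_with idtac.
Qed.

(** The search by [CMin] for a zero of the characteristic function halts exactly when there is a
    witness t. *)
Lemma ce_proj P : Dec (fun p => P (π1 p) (π2 p)) -> ce (fun x => exists t, P x t).
Proof.
  intros (f & [c Hc] & HP); exists (encode (CMin c)); intros x; split.
  - intros Hex; exists (CMin c); split; [auto|].
    destruct (dec_inh_nat_subset_has_unique_least_element
                (fun t => f ⟨x, t⟩ = 0)) as (t & [Ht Hlt] & _).
    + intros t; destruct (Nat.eq_dec (f ⟨x, t⟩) 0); auto.
    + destruct Hex as [t Ht]; exists t; apply HP; now unpair.
    + exists t; simpl; split; [generalize (Hc ⟨x, t⟩); now rewrite Ht|].
      intros m Hm; exists (pred (f ⟨x, m⟩)).
      rewrite Nat.succ_pred; [auto|intros H; specialize (Hlt _ H); lia].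
  - intros (d & Hd & t & Ht); apply encode_inj in Hd as ->.
    destruct Ht as [Ht _].
    exists t; pose proof (eval_functional _ _ _ _ Ht (Hc _)) as E.
    symmetry in E; apply HP in E; now unpair.
Qed.

Lemma ce_dec P : Dec P -> ce P.
Proof.
  intros (f & Hf & HP).
  destruct (ce_proj (fun x _ => P x)) as [e He].
  - exists (fun p => f (π1 p)); split; [comp|auto].
  - exists e; intros x; rewrite <- He; split; [now exists 0|now intros [_ H]].
Qed.

(** The index grows by 2^k for each accepted k. The part built before is below 2^k, so the addition
    has no carry and acts as a union. *)
Lemma computable_comprehension P n :
  Dec (fun p => P (π1 p) (π2 p)) -> computable n ->
  exists S, computable S /\ forall x k, bit (S x) k <-> k < n x /\ P x k.
Proof.
  intros (f & Hf & HP) Hn.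
  pose (F x k r := (1 - f ⟨x, k⟩) * 2 ^ k + r).
  exists (fun x => prec 0 (F x) (n x)); split.
  - apply (computable_prec (fun _ => 0) F); unfold F; comp.
  - intros x k; cut (prec 0 (F x) (n x) < 2 ^ n x /\
                     (bit (prec 0 (F x) (n x)) k <-> k < n x /\ P x k)); [tauto|].
    induction (n x) as [|m [IHlt IH]]; cbn [prec].
    + rewrite Nat.bits_0; simpl; split; [lia|split; [discriminate|lia]].
    + set (r := prec 0 (F x) m) in *; unfold F.
      specialize (HP ⟨x, m⟩); unpair.
      assert (Hr : forall j, m <= j -> Nat.testbit r j = false).
      { intros j Hj; rewrite <- (Nat.mod_small r (2 ^ m)) by lia.
        now apply Nat.mod_pow2_bits_high. }
      destruct (f ⟨x, m⟩) as [|y] eqn:E.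
      * replace ((1 - 0) * 2 ^ m + r) with (2 ^ m + r) by lia.
        split; [simpl; lia|].
        assert (HL : Nat.land (2 ^ m) r = 0).
        { apply Nat.bits_inj; intros j; rewrite Nat.land_spec, Nat.bits_0.
          destruct (Nat.eq_dec j m) as [->|];
            [rewrite Hr; [apply Bool.andb_false_r|lia]|].
          now rewrite Nat.pow2_bits_false by lia. }
        rewrite Nat.add_nocarry_lxor, Nat.lxor_lor by auto.
        rewrite Nat.lor_spec, Bool.orb_true_iff, IH.
        destruct (Nat.eq_dec k m) as [->|].
        { rewrite Nat.pow2_bits_true; intuition lia. }
        rewrite Nat.pow2_bits_false by lia; intuition (try congruence; try lia).
      * replace ((1 - S y) * 2 ^ m + r) with r by lia; split.
        { simpl; lia. }
        rewrite IH; destruct (Nat.eq_dec k m) as [->|]; intuition lia.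
Qed.

(** * A universal c.e. set *)

(** [L] is the canonical index of a set of triples ⟨e, ⟨x, y⟩⟩, read as: code number e maps x to y.
    A triple is justified if one clause of [eval] yields it from triples in [L]. The numerals are
    those of [encode]; all quantifiers are bounded for decidability. *)
Definition justified (L e x y : nat) : Prop :=
  (e = 0 /\ y = 0) \/ (e = 1 /\ y = S x) \/ (e = 2 /\ y = π1 x) \/ (e = 3 /\ y = π2 x) \/
  exists i, i < e /\ (
    (e = 7 + 4 * i /\ bit L ⟨i, ⟨⟨x, y⟩, 0⟩⟩ /\
     forall m, m < y -> exists v, v < L /\ bit L ⟨i, ⟨⟨x, m⟩, S v⟩⟩) \/
    exists j, j < e /\ (
      (e = 4 + 4 * ⟨i, j⟩ /\ bit L ⟨i, ⟨x, π1 y⟩⟩ /\ bit L ⟨j, ⟨x, π2 y⟩⟩) \/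
      (e = 5 + 4 * ⟨i, j⟩ /\ exists u, u < L /\ bit L ⟨j, ⟨x, u⟩⟩ /\ bit L ⟨i, ⟨u, y⟩⟩) \/
      (e = 6 + 4 * ⟨i, j⟩ /\
       ((π2 x = 0 /\ bit L ⟨i, ⟨π1 x, y⟩⟩) \/
        exists n, n < π2 x /\ π2 x = S n /\ exists w, w < L /\
          bit L ⟨e, ⟨⟨π1 x, n⟩, w⟩⟩ /\ bit L ⟨j, ⟨⟨π1 x, ⟨n, w⟩⟩, y⟩⟩)))).

(** Circular justifications cannot occur: a justification of [⟨e, ⟨x, y⟩⟩] only
    refers to smaller codes, or to the same code with a smaller [π2 x]. *)
Definition certificate (L : nat) : Prop :=
  forall p, p < L -> bit L p -> justified L (π1 p) (π1 (π2 p)) (π2 (π2 p)).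

Lemma dec_certificate f : computable f -> Dec (fun x => certificate (f x)).
Proof.
  intros Hf; unfold certificate, justified.
  dec_with ltac:(apply dec_bit; comp).
Qed.

(** A complete c.e. set, in the role of [K]. *)
Definition graph (p : nat) : Prop :=
  exists c, encode c = π1 p /\ eval c (π1 (π2 p)) (π2 (π2 p)).

Lemma graph_encode c x y : graph ⟨encode c, ⟨x, y⟩⟩ <-> eval c x y.
Proof.
  unfold graph; unpair; split; [|eauto].
  now intros (d & Hd & H); apply encode_inj in Hd as ->.
Qed.

Ltac case_justified H i j :=
  destruct H as [H|[H|[H|[H|(i & _ & [H|(j & _ & [H|[H|H]])])]]]];
  try (destruct H as [H _]; lia).

Lemma certificate_sound L c x y :
  certificate L -> bit L ⟨encode c, ⟨x, y⟩⟩ -> eval c x y.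
Proof.
  intros HL; revert x y.
  assert (J : forall e x y, bit L ⟨e, ⟨x, y⟩⟩ -> justified L e x y)
    by (intros e x y H; generalize (HL _ (bit_lt _ _ H) H); now unpair).
  assert (inj : forall i j i' j', ⟨i, j⟩ = ⟨i', j'⟩ -> i = i' /\ j = j')
    by (intros *; apply pair_inj).
  induction c as [| | | |c IHc d IHd|c IHc d IHd|c IHc d IHd|c IHc]; intros x y H.
  1-4: apply J in H; unfold justified in H; cbn [encode eval] in *;
    destruct H as [H|[H|[H|[H|(i & Hi & [H|(j & Hj & H)])]]]]; lia.
  - apply J in H; cbn [encode eval] in *.
    case_justified H i j.
    destruct H as (E & H1 & H2).
    destruct (inj (encode c) (encode d) i j ltac:(lia)) as [<- <-].
    exists (π1 y), (π2 y); rewrite pair_eta; auto.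
  - apply J in H; cbn [encode eval] in *.
    case_justified H i j.
    destruct H as (E & u & _ & H1 & H2).
    destruct (inj (encode c) (encode d) i j ltac:(lia)) as [<- <-]; eauto.
  - cbn [eval]; rewrite <- (pair_eta x) in H.
    remember (π1 x) as a; remember (π2 x) as n; clear Heqa Heqn x.
    revert y H; induction n as [|n IHn]; intros y H;
      apply J in H; cbn [encode] in *;
      case_justified H i j;
      destruct H as (E & H);
      destruct (inj (encode c) (encode d) i j ltac:(lia)) as [<- <-]; unpair;
      destruct H as [[H1 H]|(n' & _ & H1 & w & _ & H2 & H3)]; try discriminate; auto.
    injection H1 as <-; exists w; split; [apply IHn|]; auto.
  - apply J in H; cbn [encode eval] in *.
    case_justified H i j.
    destruct H as (E & H1 & H2); replace i with (encode c) in * by lia.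
    split; auto.
    intros m Hm; destruct (H2 m Hm) as (v & _ & Hv); eauto.
Qed.

(** The bounds on values survive the passage to [L'] because the components of a triple in [L'] are
    below [L']. *)
Lemma justified_mono L L' e x y :
  (forall p, bit L p -> bit L' p) -> justified L e x y -> justified L' e x y.
Proof.
  intros HL; unfold justified.
  assert (lt : forall i a b, bit L' ⟨i, ⟨a, b⟩⟩ -> b < L').
  { intros i a b H; apply bit_lt in H.
    pose proof (pair_ge i ⟨a, b⟩); pose proof (pair_ge a b); lia. }
  intros [H|[H|[H|[H|(i & Hi & [(E & H1 & H2)|(j & Hj & [H|[H|H]])])]]]]; auto;
    do 4 right; exists i; split; auto.
  - left; split; [auto|split; [auto|]]; intros m Hm; destruct (H2 m Hm) as (v & _ & Hv).
    exists v; split; auto; apply HL, lt in Hv; lia.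
  - right; exists j; split; auto; left; intuition.
  - right; exists j; split; auto; right; left.
    destruct H as (E & u & _ & H1 & H2); split; auto; exists u.
    split; [apply (lt j x); auto|auto].
  - right; exists j; split; auto; right; right.
    destruct H as (E & [[H1 H2]|(n & Hn & H1 & w & _ & H2 & H3)]); split; auto.
    right; exists n; split; auto; split; auto; exists w.
    split; [apply (lt e ⟨π1 x, n⟩); auto|auto].
Qed.

Lemma certificate_lor L L' :
  certificate L -> certificate L' -> certificate (Nat.lor L L').
Proof.
  intros H H' p _ Hp; rewrite Nat.lor_spec in Hp; apply Bool.orb_true_iff in Hp.
  destruct Hp as [Hp|Hp].
  - eapply justified_mono; [|apply H; auto; now apply bit_lt].
    intros; rewrite Nat.lor_spec; apply Bool.orb_true_iff; auto.
  - eapply justified_mono; [|apply H'; auto; now apply bit_lt].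
    intros; rewrite Nat.lor_spec; apply Bool.orb_true_iff; auto.
Qed.

Lemma certificate_add L e x y :
  certificate L -> justified L e x y ->
  exists L', certificate L' /\ bit L' ⟨e, ⟨x, y⟩⟩.
Proof.
  intros HL HJ; exists (Nat.lor L (2 ^ ⟨e, ⟨x, y⟩⟩)).
  assert (sub : forall p, bit L p -> bit (Nat.lor L (2 ^ ⟨e, ⟨x, y⟩⟩)) p)
    by (intros p Hp; rewrite Nat.lor_spec, Hp; auto).
  split.
  - intros p _ Hp; apply (justified_mono L); auto.
    rewrite Nat.lor_spec in Hp; apply Bool.orb_true_iff in Hp as [Hp|Hp].
    + apply HL; auto; now apply bit_lt.
    + rewrite Nat.pow2_bits_eqb in Hp; apply Nat.eqb_eq in Hp as <-; now unpair.
  - rewrite Nat.lor_spec, Nat.pow2_bits_true; apply Bool.orb_true_r.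
Qed.

Definition certified (p : nat) : Prop := exists L, certificate L /\ bit L p.

Lemma certified_finite (g : nat -> nat) n :
  (forall m, m < n -> certified (g m)) ->
  exists L, certificate L /\ forall m, m < n -> bit L (g m).
Proof.
  induction n as [|n IH]; intros H.
  - exists 0; split; [|lia].
    intros p Hp; lia.
  - destruct IH as (L & HL & IH); [auto|].
    destruct (H n (Nat.lt_succ_diag_r n)) as (L' & HL' & Hn).
    exists (Nat.lor L L'); split; [now apply certificate_lor|].
    intros m Hm; rewrite Nat.lor_spec; apply Bool.orb_true_iff.
    destruct (Nat.eq_dec m n) as [->|]; [auto|left; apply IH; lia].
Qed.

Lemma certified_pair p q :
  certified p -> certified q ->
  exists L, certificate L /\ bit L p /\ bit L q.
Proof.
  intros (L & HL & Hp) (L' & HL' & Hq); exists (Nat.lor L L').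
  split; [now apply certificate_lor|].
  rewrite !Nat.lor_spec, Hp, Hq; split; [auto|apply Bool.orb_true_r].
Qed.

Lemma bit_triple_lt L e x y : bit L ⟨e, ⟨x, y⟩⟩ -> y < L.
Proof.
  intros H; apply bit_lt in H.
  pose proof (pair_ge e ⟨x, y⟩); pose proof (pair_ge x y); lia.
Qed.

Lemma certificate_complete c x y : eval c x y -> certified ⟨encode c, ⟨x, y⟩⟩.
Proof.
  assert (sub : forall i j, i <= ⟨i, j⟩ /\ j <= ⟨i, j⟩) by apply pair_ge.
  revert x y; induction c as [| | | |c IHc d IHd|c IHc d IHd|c IHc d IHd|c IHc];
    intros x y H; cbn [encode].
  1-4: apply (certificate_add 0); [intros p Hp; lia|unfold justified; simpl in H; auto 8].
  - destruct H as (u & v & Hu & Hv & ->).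
    destruct (certified_pair _ _ (IHc _ _ Hu) (IHd _ _ Hv)) as (L & HL & H1 & H2).
    apply (certificate_add L); auto.
    specialize (sub (encode c) (encode d)).
    do 4 right; exists (encode c); split; [lia|right].
    exists (encode d); split; [lia|left]; unpair; auto.
  - destruct H as (u & Hu & Hy).
    destruct (certified_pair _ _ (IHc _ _ Hy) (IHd _ _ Hu)) as (L & HL & H1 & H2).
    apply (certificate_add L); auto.
    specialize (sub (encode c) (encode d)).
    do 4 right; exists (encode c); split; [lia|right].
    exists (encode d); split; [lia|right; left]; split; auto.
    exists u; split; auto; eapply bit_triple_lt; eauto.
  - rewrite <- (pair_eta x); cbn [eval] in H.
    set (a := π1 x) in *; set (n := π2 x) in *; clearbody a n; clear x.
    specialize (sub (encode c) (encode d)).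
    revert y H; induction n as [|n IHn]; intros y H.
    + destruct (IHc _ _ H) as (L & HL & H1).
      apply (certificate_add L); auto.
      do 4 right; exists (encode c); split; [lia|right].
      exists (encode d); split; [lia|right; right]; unpair; auto.
    + destruct H as (w & Hw & Hy).
      destruct (certified_pair _ _ (IHn _ Hw) (IHd _ _ Hy)) as (L & HL & H1 & H2).
      apply (certificate_add L); auto.
      do 4 right; exists (encode c); split; [lia|right].
      exists (encode d); split; [lia|right; right]; unpair; split; auto.
      right; exists n; split; auto; split; auto; exists w; split; auto.
      eapply bit_triple_lt; eauto.
  - destruct H as [H0 Hlt].
    (* Finite choice: the nonzero values met before the search stops are gathered into one
       function. *)
    assert (HF : exists v, forall m, m < y -> eval c ⟨x, m⟩ (S (v m))).
    { clear H0; induction y as [|y IH].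
      - exists (fun _ => 0); lia.
      - destruct (Hlt y) as [w Hw]; [auto|]; destruct IH as [v Hv]; [auto|].
        exists (fun m => if Nat.eq_dec m y then w else v m); intros m Hm.
        destruct (Nat.eq_dec m y) as [->|]; auto; apply Hv; lia. }
    destruct HF as [v Hv].
    destruct (certified_finite (fun m => ⟨encode c, ⟨⟨x, m⟩, S (v m)⟩⟩) y)
      as (L & HL & H1); [auto|].
    destruct (IHc _ _ H0) as (L' & HL' & H2).
    apply (certificate_add (Nat.lor L L')); [now apply certificate_lor|].
    assert (HLor : forall p, bit L p \/ bit L' p -> bit (Nat.lor L L') p)
      by (intros p; rewrite Nat.lor_spec, Bool.orb_true_iff; auto).
    do 4 right; exists (encode c); split; [lia|left].
    split; [lia|split; [auto|]].
    intros m Hm; exists (v m); split; [|auto].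
    apply Nat.lt_succ_l; eapply bit_triple_lt; eauto.
Qed.

Lemma graph_certified p : graph p <-> certified p.
Proof.
  destruct (encode_surj (π1 p)) as [c Hc].
  rewrite <- (pair_eta p), <- (pair_eta (π2 p)), <- Hc, graph_encode; split.
  - apply certificate_complete.
  - intros (L & HL & H); eapply certificate_sound; eauto.
Qed.

(** Stage [t] is the attempt to enumerate [π1 t] with the certificate [π2 t]. *)
Definition enum (t : nat) : Prop := certificate (π2 t) /\ bit (π2 t) (π1 t).

Lemma dec_enum f : computable f -> Dec (fun x => enum (f x)).
Proof.
  intros Hf; unfold enum; apply dec_and.
  - apply dec_certificate; comp.
  - apply dec_bit; comp.
Qed.

Lemma graph_enum p : graph p <-> exists t, enum t /\ π1 t = p.
Proof.
  rewrite graph_certified; split.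
  - intros (L & HL & Hp); exists ⟨p, L⟩; unfold enum; unpair; auto.
  - intros (t & [HL Ht] & <-); exists (π2 t); auto.
Qed.

(** Composing with [CZero] makes every value 0, so that convergence at x becomes membership of a
    single triple in [graph]. *)
Lemma ce_eval A : ce A -> exists c, forall x, A x <-> eval c x 0.
Proof.
  intros [e He]; destruct (encode_surj e) as [c Hc]; exists (CComp CZero c).
  intros x; rewrite He; split.
  - intros (d & Hd & y & Hy); rewrite <- Hc in Hd; apply encode_inj in Hd as ->.
    simpl; eauto.
  - intros (y & Hy & _); exists c; eauto.
Qed.

Lemma ce_graph_reducible A :
  ce A -> exists k, computable k /\ forall x, A x <-> graph (k x).
Proof.
  intros HA; destruct (ce_eval A HA) as [c Hc].
  exists (fun x => ⟨encode c, ⟨x, 0⟩⟩); split; [comp|].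
  intros x; now rewrite graph_encode.
Qed.

Lemma graph_not_co_ce : ~ ce (fun p => ~ graph p).
Proof.
  intros [e He]; destruct (encode_surj e) as [c Hc].
  destruct computable_id as [i Hi].
  (* [d] is the diagonal function, defined exactly where [~ graph ⟨x, ⟨x, 0⟩⟩]. *)
  pose (d := CComp CZero (CComp c (CPair i (CPair i CZero)))).
  assert (E : forall x, eval d x 0 <-> ~ graph ⟨x, ⟨x, 0⟩⟩).
  { intros x; rewrite He; split.
    - intros (y & (u & (a & b & Ha & (a' & b' & Ha' & Hb' & ->) & ->) & Hy) & _).
      rewrite (eval_functional _ _ _ _ Ha (Hi x)),
        (eval_functional _ _ _ _ Ha' (Hi x)), Hb' in Hy.
      exists c; eauto.
    - intros (c' & Hc' & y & Hy); rewrite <- Hc in Hc'; apply encode_inj in Hc' as ->.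
      exists y; split; [|reflexivity].
      exists ⟨x, ⟨x, 0⟩⟩; split; [|auto].
      exists x, ⟨x, 0⟩; split; [auto|split; [|auto]].
      exists x, 0; simpl; auto. }
  specialize (E (encode d)); rewrite graph_encode in E; tauto.
Qed.

Fixpoint const_index (n : nat) : nat :=
  match n with 0 => 0 | S n => 5 + 4 * ⟨1, const_index n⟩ end.

Lemma encode_const n : encode (const n) = const_index n.
Proof. induction n as [|n IH]; auto; cbn [const encode const_index]; now rewrite IH. Qed.

Lemma computable_const_index f :
  computable f -> computable (fun x => const_index (f x)).
Proof.
  intros Hf.
  apply (computable_ext (fun x => prec 0 (fun _ r => 5 + 4 * ⟨1, r⟩) (f x))).
  - intros x; induction (f x) as [|n IH]; auto.
    cbn [prec const_index]; now rewrite IH.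
  - apply (computable_prec (fun _ => 0) (fun _ _ r => 5 + 4 * ⟨1, r⟩)); auto;
      [comp|].
    change (computable (fun p => 5 + 4 * ⟨1, π2 (π2 p)⟩)); comp.
Qed.

(** An instance of the s-m-n theorem: x is hard-wired by the code [const x], whose number is
    computable from x. *)
Lemma uniform_ce R :
  ce R -> exists g, computable g /\ forall x y, W (g x) y <-> R ⟨x, y⟩.
Proof.
  intros [e He]; destruct (encode_surj e) as [c Hc].
  destruct computable_id as [i Hi].
  exists (fun x => 5 + 4 * ⟨e, 4 + 4 * ⟨const_index x, encode i⟩⟩); split.
  - apply (computable_add (fun _ => 5)); [comp|].
    apply (computable_mul (fun _ => 4)); [comp|].
    apply computable_pair; [comp|].
    apply (computable_add (fun _ => 4)); [comp|].
    apply (computable_mul (fun _ => 4)); [comp|].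
    apply computable_pair; [apply computable_const_index|]; comp.
  - intros x y.
    replace (5 + _) with (encode (CComp c (CPair (const x) i)))
      by (cbn [encode]; now rewrite encode_const, Hc).
    rewrite He; split.
    + intros (d & Hd & z & Hz); apply encode_inj in Hd as ->.
      destruct Hz as (u & (a & b & Ha & Hb & ->) & Hz).
      rewrite (eval_functional _ _ _ _ Ha (eval_const x y)),
        (eval_functional _ _ _ _ Hb (Hi y)) in Hz.
      exists c; eauto.
    + intros (c' & Hc' & z & Hz); rewrite <- Hc in Hc'; apply encode_inj in Hc' as ->.
      eexists; split; [reflexivity|]; exists z, ⟨x, y⟩; split; [|auto].
      exists x, y; split; [apply eval_const|auto].
Qed.

(** * The construction *)

Definition enumerated (s v : nat) : Prop := exists t, t < s /\ enum t /\ π1 t = v.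

(** A claim [⟨e, q⟩] is the wish of requirement [e] to keep [q] out of [A]; a set
    of claims is given by its canonical index [C].  Among the claims on numbers
    [q = ⟨i, x⟩] with the same [x], those of the least [e] prevail. *)
Definition protected (C q : nat) : Prop :=
  exists e, e < C /\ bit C ⟨e, q⟩ /\
    forall p, p < C -> bit C p -> π2 (π2 p) = π2 q -> e <= π1 p.

(** [A] at stage [t], when the claims [C] have been made. *)
Definition in_stage (C t q : nat) : Prop :=
  (π1 q = 0 /\ exists v, v < π1 (π2 q) /\ enumerated t v /\ ~ enumerated (π2 (π2 q)) v) \/
  (π1 q <> 0 /\ enumerated t (π2 q) /\ ~ protected C q).

(** Stage [t] enumerates [⟨fn t, ⟨arg t, val t⟩⟩], which says that the function
    with code [fn t] maps [arg t] to [val t]. *)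
Notation fn t := (π1 (π1 t)).
Notation arg t := (π1 (π2 (π1 t))).
Notation val t := (π2 (π2 (π1 t))).

(** Diagonalization against the function [e] uses the column [⟨e, ⟨m, k⟩⟩] of
    numbers; each of them is treated once, when its value is enumerated. *)
Definition attacks (t : nat) : Prop :=
  enum t /\ ~ enumerated t (π1 t) /\ π1 (arg t) = fn t.

(** A requirement makes a new claim only after all its former claims have failed. *)
Definition claims (t C q : nat) : Prop :=
  attacks t /\
  (bit (val t) q /\ π1 q <> 0 /\ ~ in_stage C t q) /\
  (forall r, r < q -> bit (val t) r -> π1 r <> 0 -> in_stage C t r) /\
  (forall p, p < C -> bit C p -> π1 p = fn t -> in_stage C t (π2 p)).

(** [val t] contains some [⟨0, ⟨n, s⟩⟩] that is not yet in [A], with [n < m] for the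
    row [m] of [arg t].  It stays outside [A] if the enumeration of [graph] has
    settled below [m]. *)
Definition guarded (t C : nat) : Prop :=
  exists q, q < val t /\
    bit (val t) q /\ π1 q = 0 /\ π1 (π2 q) < π1 (π2 (arg t)) /\ ~ in_stage C t q.

Definition claim_history (St : nat -> nat) : Prop :=
  St 0 = 0 /\
  forall t p, bit (St (S t)) p <->
    bit (St t) p \/ (π1 p = fn t /\ claims t (St t) (π2 p)).

Definition setA (St : nat -> nat) (q : nat) : Prop := exists t, in_stage (St t) t q.

Definition setB (St : nat -> nat) (z : nat) : Prop :=
  exists t, arg t = z /\ attacks t /\
    (guarded t (St t) \/ exists q, q < val t /\ claims t (St t) q).

(** * Decidability of the construction *)

Lemma dec_enumerated f g :
  computable f -> computable g -> Dec (fun x => enumerated (f x) (g x)).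
Proof.
  intros Hf Hg; unfold enumerated.
  dec_with ltac:(apply dec_enum; comp).
Qed.

Lemma dec_protected f g :
  computable f -> computable g -> Dec (fun x => protected (f x) (g x)).
Proof.
  intros Hf Hg; unfold protected.
  dec_with ltac:(apply dec_bit; comp).
Qed.

Lemma dec_in_stage f g h :
  computable f -> computable g -> computable h ->
  Dec (fun x => in_stage (f x) (g x) (h x)).
Proof.
  intros Hf Hg Hh; unfold in_stage.
  dec_with ltac:(first [apply dec_enumerated | apply dec_protected]; comp).
Qed.

Lemma dec_attacks f : computable f -> Dec (fun x => attacks (f x)).
Proof.
  intros Hf; unfold attacks.
  dec_with ltac:(first [apply dec_enumerated | apply dec_enum]; comp).
Qed.

Lemma dec_claims f g h :
  computable f -> computable g -> computable h ->
  Dec (fun x => claims (f x) (g x) (h x)).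
Proof.
  intros Hf Hg Hh; unfold claims.
  dec_with ltac:(first [apply dec_attacks | apply dec_in_stage | apply dec_bit]; comp).
Qed.

Lemma dec_guarded f g :
  computable f -> computable g -> Dec (fun x => guarded (f x) (g x)).
Proof.
  intros Hf Hg; unfold guarded.
  dec_with ltac:(first [apply dec_in_stage | apply dec_bit]; comp).
Qed.

Lemma claim_history_exists : exists St, computable St /\ claim_history St.
Proof.
  destruct (computable_comprehension
    (fun x p => bit (π2 x) p \/
       (π1 p = fn (π1 x) /\ claims (π1 x) (π2 x) (π2 p)))
    (* An old claim is below the old index, and a new one is ⟨fn t, q⟩ with q < val t, so this bound
       cuts off no claim. *)
    (fun x => π2 x + S ⟨fn (π1 x), val (π1 x)⟩)) as (step & Hstep & H).
  - dec_with ltac:(first [apply dec_claims | apply dec_bit]; comp).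
  - comp.
  - exists (prec 0 (fun t C => step ⟨t, C⟩)); split.
    + apply (computable_prec (fun _ => 0) (fun _ t C => step ⟨t, C⟩) (fun x => x)); comp.
    + split; [auto|]; intros t p; cbn [prec]; rewrite H; unpair.
      split; [tauto|]; intros Hp; split; [|auto].
      destruct Hp as [Hp|[Hp Hq]]; [apply bit_lt in Hp; lia|].
      destruct Hq as (_ & (Hq & _) & _); apply bit_lt in Hq.
      rewrite <- (pair_eta p), Hp.
      pose proof (pair_le_mono (fn t) (π2 p) (val t)); lia.
Qed.

(** * Persistence and finite injury *)

Lemma enumerated_mono s t v : s <= t -> enumerated s v -> enumerated t v.
Proof. intros Hst (u & Hu & H); exists u; split; [lia|auto]. Qed.

Lemma enumerated_graph s v : enumerated s v -> graph v.
Proof. intros (u & Hu & H); apply graph_enum; eauto. Qed.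

Lemma graph_enumerated v : graph v -> exists s, enumerated s v.
Proof.
  intros H; apply graph_enum in H as [t H]; exists (S t), t; split; [lia|auto].
Qed.

Lemma settled n s0 : exists s, s0 <= s /\ forall v, v < n -> graph v -> enumerated s v.
Proof.
  induction n as [|n (s & Hs & IH)]; [exists s0; split; [auto|lia]|].
  destruct (classic (graph n)) as [Hn|Hn].
  - destruct (graph_enumerated n Hn) as [s' Hs']; exists (s + s'); split; [lia|].
    intros v Hv Gv; destruct (Nat.eq_dec v n) as [->|].
    + apply (enumerated_mono s'); [lia|auto].
    + apply (enumerated_mono s); [lia|apply IH; [lia|auto]].
  - exists s; split; [auto|]; intros v Hv Gv.
    destruct (Nat.eq_dec v n) as [->|]; [tauto|apply IH; [lia|auto]].
Qed.

Lemma protected_spec C q :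
  protected C q <-> exists e, bit C ⟨e, q⟩ /\
    forall e' q', bit C ⟨e', q'⟩ -> π2 q' = π2 q -> e <= e'.
Proof.
  split; intros (e & H).
  - destruct H as (_ & H1 & H2); exists e; split; [auto|].
    intros e' q' H' E; specialize (H2 _ (bit_lt _ _ H') H'); unpair; auto.
  - destruct H as [H1 H2]; exists e; split.
    + pose proof (bit_lt _ _ H1); pose proof (pair_ge e q); lia.
    + split; [auto|]; intros p _ Hp E; apply (H2 _ (π2 p)); [|auto].
      now rewrite pair_eta.
Qed.

Lemma history_step St t e q : claim_history St ->
  (bit (St (S t)) ⟨e, q⟩ <->
   bit (St t) ⟨e, q⟩ \/ (e = fn t /\ claims t (St t) q)).
Proof. intros [_ H]; rewrite H; unpair; tauto. Qed.

Lemma claims_unique t C q r : claims t C q -> claims t C r -> q = r.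
Proof.
  intros (_ & (Hq1 & Hq2 & Hq3) & Hq & _) (_ & (Hr1 & Hr2 & Hr3) & Hr & _).
  destruct (Nat.lt_total q r) as [H|[H|H]]; [|auto|]; exfalso; auto.
Qed.

Lemma claims_new t C q : claims t C q -> π1 q <> 0 /\ ~ in_stage C t q.
Proof. unfold claims; tauto. Qed.

Lemma claims_old t C q r : claims t C q -> bit C ⟨fn t, r⟩ -> in_stage C t r.
Proof.
  intros (_ & _ & _ & H) Hr; specialize (H _ (bit_lt _ _ Hr) Hr); unpair; auto.
Qed.

Lemma not_in_stage_protected C t q :
  π1 q <> 0 -> enumerated t (π2 q) -> ~ in_stage C t q -> protected C q.
Proof. unfold in_stage; intros; apply NNPP; tauto. Qed.

(** Both numbers are claimed by the same least requirement. Were one claim newer, the other would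
    have failed before, which is impossible while it is protected. *)
Lemma protected_unique St t q r :
  claim_history St -> π1 q <> 0 -> π1 r <> 0 -> π2 q = π2 r ->
  protected (St t) q -> protected (St t) r -> q = r.
Proof.
  intros HS Hq Hr E; induction t as [|t IH].
  - destruct HS as [HS _]; rewrite HS; intros (e & He & _); lia.
  - rewrite !protected_spec in *.
    intros (e & He & Hmin) (e' & He' & Hmin').
    assert (e' = e) as ->.
    { apply Nat.le_antisymm; [apply (Hmin' e q)|apply (Hmin e' r)]; auto. }
    assert (old : forall q', π2 q' = π2 q -> bit (St t) ⟨e, q'⟩ -> protected (St t) q').
    { intros q' Eq Hb; apply protected_spec; exists e; split; [auto|].
      intros e1 q1 H1 E1; apply (Hmin e1 q1); [apply history_step; auto|congruence]. }
    apply history_step in He; apply history_step in He'; auto.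
    assert (clash : forall q1 q2, π2 q2 = π2 q -> π1 q2 <> 0 ->
              bit (St t) ⟨e, q2⟩ -> e = fn t -> claims t (St t) q1 -> False).
    { intros q1 q2 E2 Hq2 Hb -> Hc; specialize (claims_old _ _ _ _ Hc Hb).
      specialize (old q2 E2 Hb); unfold in_stage; tauto. }
    destruct He as [He|[Ee He]], He' as [He'|[Ee' He']].
    + rewrite <- !protected_spec in IH; auto.
    + exfalso; apply (clash r q); auto.
    + exfalso; apply (clash q r); auto.
    + eapply claims_unique; eauto.
Qed.

(** A new claim concerns a number outside the current [in_stage]; as its second component is already
    enumerated, that number was protected before. *)
Lemma protected_step_inv St t q :
  claim_history St -> π1 q <> 0 -> enumerated t (π2 q) ->
  protected (St (S t)) q -> protected (St t) q.
Proof.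
  intros HS Hq Hx; rewrite !protected_spec; intros (e & He & Hmin).
  apply history_step in He; auto; destruct He as [He|[-> He]].
  - exists e; split; [auto|]; intros e1 q1 H1; apply Hmin, history_step; auto.
  - apply claims_new in He as [_ He].
    now apply protected_spec; apply (not_in_stage_protected _ t).
Qed.

(** Only a new claim of a smaller requirement on the same second component could matter. By
    uniqueness it is a claim on q itself, so q merely changes its protector. *)
Lemma protected_step St t q :
  claim_history St -> π1 q <> 0 -> enumerated t (π2 q) ->
  protected (St t) q -> protected (St (S t)) q.
Proof.
  intros HS Hq Hx HP; pose proof HP as HP'; rewrite protected_spec in *.
  destruct HP' as (e & He & Hmin).
  destruct (classic (exists r, claims t (St t) r /\ π2 r = π2 q /\ fn t < e))
    as [(r & Hr & E & Hlt)|Hno].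
  - destruct (claims_new _ _ _ Hr) as [Hr0 Hr1].
    assert (r = q) as ->.
    { apply (protected_unique St t); auto.
      - apply (not_in_stage_protected _ t); auto; now rewrite E.
      - now apply protected_spec. }
    exists (fn t); split; [apply history_step; auto|].
    intros e1 q1 H1 E1; apply history_step in H1; auto.
    destruct H1 as [H1|[-> _]]; [|auto]; specialize (Hmin _ _ H1 E1); lia.
  - exists e; split; [apply history_step; auto|].
    intros e1 q1 H1 E1; apply history_step in H1; auto.
    destruct H1 as [H1|[-> H1]]; [eauto|].
    destruct (le_lt_dec e (fn t)) as [H|H]; [auto|exfalso; eauto].
Qed.

(** After [x] has been enumerated, a new claim on some [⟨i, x⟩] can only concern
    the number already protected; hence the numbers put into [A] stay there. *)
Lemma in_stage_mono St s t q :
  claim_history St -> s <= t -> in_stage (St s) s q -> in_stage (St t) t q.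
Proof.
  intros HS Hst H; induction Hst as [|t Hst IH]; [auto|].
  destruct IH as [(Hq & v & Hv & H1 & H2)|(Hq & H1 & H2)].
  - left; split; [auto|]; exists v; split; [auto|split; [|auto]].
    apply (enumerated_mono t); [lia|auto].
  - right; split; [auto|split].
    + apply (enumerated_mono t); [lia|auto].
    + intros HP; apply H2, protected_step_inv; auto.
Qed.

Lemma history_mono St s t p :
  claim_history St -> s <= t -> bit (St s) p -> bit (St t) p.
Proof. intros [_ HS] Hst H; induction Hst; [auto|apply HS; auto]. Qed.

Lemma history_origin St t e q :
  claim_history St -> bit (St t) ⟨e, q⟩ ->
  exists s, s < t /\ e = fn s /\ claims s (St s) q.
Proof.
  intros HS; induction t as [|t IH].
  - destruct HS as [HS _]; rewrite HS, Nat.bits_0; discriminate.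
  - rewrite history_step by auto; intros [H|[-> H]]; [|eauto].
    destruct (IH H) as (s & Hs & ?); exists s; split; [lia|auto].
Qed.

Lemma not_in_stage_persistent St s t q :
  claim_history St -> s <= t -> π1 q <> 0 -> enumerated s (π2 q) ->
  ~ in_stage (St s) s q -> ~ in_stage (St t) t q.
Proof.
  intros HS Hst Hq Hx H.
  apply not_in_stage_protected in H; auto.
  cut (protected (St t) q); [unfold in_stage; tauto|].
  induction Hst as [|t Hst IH]; [auto|].
  apply protected_step; auto; eapply enumerated_mono; eauto.
Qed.

(** Once the requirements below [e] have stopped claiming, and the finitely many
    [x] they claimed have been enumerated or never will be, a claim of [e] is
    permanent. *)
Lemma finitely_many_claims St e :
  claim_history St ->
  exists t0, forall t q, t0 <= t -> fn t = e -> ~ claims t (St t) q.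
Proof.
  intros HS; induction e as [e IH] using lt_wf_ind.
  assert (Hlow : exists t0, forall t q, t0 <= t -> fn t < e -> ~ claims t (St t) q).
  { clear - IH; induction e as [|e IHe]; [exists 0; lia|].
    destruct IHe as [s Hs]; [intros; apply IH; lia|].
    destruct (IH e) as [s' Hs']; [lia|].
    exists (s + s'); intros t q Ht He.
    destruct (Nat.eq_dec (fn t) e); [apply Hs'; lia|apply Hs; lia]. }
  destruct Hlow as [t0 Ht0].
  (* Second components of numbers claimed before t0 are below [St t0], since claims are bits of
     it. *)
  destruct (settled (St t0) t0) as (t1 & Ht1 & Hsettled).
  destruct (classic (exists t q, t1 <= t /\ fn t = e /\ claims t (St t) q))
    as [(t & q & Ht & He & Hq)|Hno]; [|exists t1; intros t q ? ? ?; apply Hno; eauto].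
  exists (S t); intros s r Hs Hr Hc.
  destruct (claims_new _ _ _ Hq) as [Hq0 Hq1].
  assert (Hb : bit (St s) ⟨fn s, q⟩).
  { apply (history_mono _ (S t)); auto; rewrite Hr.
    apply history_step; auto. }
  pose proof (claims_old _ _ _ _ Hc Hb) as Hin.
  destruct (classic (enumerated t (π2 q))) as [Hx|Hx].
  { revert Hin; apply (not_in_stage_persistent _ t); auto; lia. }
  destruct Hin as [[? _]|(_ & Hxs & HnP)]; [tauto|].
  (* The second component of q entered only after t1. A stronger claim on it would stem from before
     t0, and then t1 would have settled it. *)
  apply HnP, protected_spec; exists e; split; [congruence|].
  intros e' q' Hb' E'; destruct (le_lt_dec e e') as [|Hlt]; [auto|exfalso].
  destruct (history_origin _ _ _ _ HS Hb') as (s' & Hs' & -> & Hc').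
  destruct (le_lt_dec t0 s') as [Hle|Hgt]; [exact (Ht0 _ _ Hle Hlt Hc')|].
  apply Hx, (enumerated_mono t1); [auto|].
  apply Hsettled; [|eapply enumerated_graph; eauto].
  assert (Hb0 : bit (St t0) ⟨fn s', q'⟩).
  { apply (history_mono _ (S s')); auto; apply history_step; auto. }
  apply bit_lt in Hb0; pose proof (pair_ge (fn s') q'); pose proof (proj_le q'); lia.
Qed.

(** * Q-completeness and bd-completeness *)

Lemma ce_setA St : computable St -> ce (setA St).
Proof.
  intros HS; unfold setA; apply (ce_proj (fun q t => in_stage (St t) t q)).
  dec_with ltac:(apply dec_in_stage; comp).
Qed.

Lemma ce_setB St : computable St -> ce (setB St).
Proof.
  intros HS; unfold setB.
  apply (ce_proj (fun z t => arg t = z /\ attacks t /\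
           (guarded t (St t) \/ exists q, q < val t /\ claims t (St t) q))).
  dec_with ltac:(first [apply dec_attacks | apply dec_guarded | apply dec_claims]; comp).
Qed.

Lemma setA_Q_complete St :
  computable St -> claim_history St -> complete le_Q (setA St).
Proof.
  intros HSt HS; split; [now apply ce_setA|].
  intros X HX; destruct (ce_graph_reducible X HX) as (k & Hk & HXk).
  destruct (uniform_ce (fun p => π1 (π2 p) = 0 /\ π1 (π2 (π2 p)) = S (π1 p) /\
      ~ enumerated (π2 (π2 (π2 p))) (π1 p))) as (g & Hg & HW).
  { apply ce_dec; dec_with ltac:(apply dec_enumerated; comp). }
  exists (fun x => g (k x)); split; [comp|].
  intros x; rewrite HXk; generalize (k x); clear x; intros v; split.
  - intros Hv q Hq; apply HW in Hq as (Hq0 & Hq1 & Hq2); unpair.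
    destruct (graph_enumerated v Hv) as [t Ht].
    exists t; left; split; [auto|]; exists v; split; [lia|auto].
  - intros H; apply NNPP; intros Hv.
    (* With nothing below v + 1 entering after s, the number ⟨0, ⟨v + 1, s⟩⟩ never enters A. *)
    destruct (settled (S v) 0) as (s & _ & Hs).
    destruct (H ⟨0, ⟨S v, s⟩⟩) as [t [(_ & w & Hw & H1 & H2)|(H0 & _)]]; unpair.
    + apply HW; unpair; repeat split; auto.
      intros H1; apply Hv; eapply enumerated_graph; eauto.
    + apply H2, Hs; [auto|]; eapply enumerated_graph; eauto.
    + auto.
Qed.

Lemma in_pair_set x y z : x <> y -> In z (D (2 ^ x + 2 ^ y)) <-> z = x \/ z = y.
Proof.
  intros Hxy; rewrite in_D.
  assert (HL : Nat.land (2 ^ x) (2 ^ y) = 0).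
  { apply Nat.bits_inj; intros j; rewrite Nat.land_spec, Nat.bits_0, !Nat.pow2_bits_eqb.
    destruct (Nat.eqb_spec x j), (Nat.eqb_spec y j); simpl; congruence. }
  rewrite Nat.add_nocarry_lxor, Nat.lxor_lor by auto.
  rewrite Nat.lor_spec, Bool.orb_true_iff, !Nat.pow2_bits_eqb, !Nat.eqb_eq.
  intuition.
Qed.

Lemma setA_bd_complete St :
  computable St -> claim_history St -> complete le_bd (setA St).
Proof.
  intros HSt HS; split; [now apply ce_setA|].
  intros X HX; destruct (ce_graph_reducible X HX) as (k & Hk & HXk).
  exists (fun x => 2 ^ ⟨1, k x⟩ + 2 ^ ⟨2, k x⟩), 3; split; [comp|].
  intros x; rewrite HXk; generalize (k x); clear x; intros v.
  assert (Hne : ⟨1, v⟩ <> ⟨2, v⟩) by (intros E; apply pair_inj in E; lia).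
  split.
  - split.
    + intros Hv; destruct (graph_enumerated v Hv) as [t Ht].
      (* At most one number with second component v is protected. *)
      assert (Hin : ~ protected (St t) ⟨1, v⟩ \/ ~ protected (St t) ⟨2, v⟩).
      { apply not_and_or; intros [H1 H2]; apply Hne.
        apply (protected_unique St t); unpair; auto. }
      destruct Hin as [H|H]; [exists ⟨1, v⟩|exists ⟨2, v⟩];
        (split; [apply in_pair_set; auto|exists t; right; unpair; auto]).
    + intros (y & Hy & t & Ht); apply in_pair_set in Hy; auto.
      destruct Hy as [-> | ->]; destruct Ht as [(H & _)|(_ & H & _)]; unpair;
        try discriminate; eapply enumerated_graph; eauto.
  - apply (Nat.le_lt_trans _ (length (⟨1, v⟩ :: ⟨2, v⟩ :: nil))); [|simpl; lia].
    apply NoDup_incl_length; [apply NoDup_D|].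
    intros y Hy; apply in_pair_set in Hy; auto; simpl; intuition.
Qed.

(** * Diagonalization against c-reductions *)

Lemma attacks_unique s t : attacks s -> attacks t -> π1 s = π1 t -> s = t.
Proof.
  intros (Es & Fs & _) (Et & Ft & _) E.
  destruct (Nat.lt_total s t) as [H|[H|H]]; [|auto|]; exfalso.
  - apply Ft; exists s; auto.
  - apply Fs; exists t; auto.
Qed.

(** Several certificates may enumerate p; the first such stage is the one that [attacks]
    requires. *)
Lemma enumeration_stage p :
  graph p -> exists t, enum t /\ ~ enumerated t (π1 t) /\ π1 t = p.
Proof.
  intros Hp; destruct (graph_enumerated p Hp) as [s Hs].
  revert Hs; induction s as [s IH] using lt_wf_ind; intros (t & Ht & He & Hpt).
  destruct (classic (enumerated t p)) as [H|H]; [eauto|].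
  exists t; subst p; auto.
Qed.

Lemma attacks_eval c t : attacks t -> fn t = encode c -> eval c (arg t) (val t).
Proof.
  intros (Ht & _) Hc; apply graph_encode.
  rewrite <- Hc, !pair_eta; apply graph_enum; eauto.
Qed.

Lemma claims_exist t C :
  attacks t ->
  (exists q, bit (val t) q /\ π1 q <> 0 /\ ~ in_stage C t q) ->
  (forall r, bit C ⟨fn t, r⟩ -> in_stage C t r) ->
  exists q, claims t C q.
Proof.
  intros Ht [q Hq] Hall; revert Hq; induction q as [q IH] using lt_wf_ind; intros Hq.
  destruct (classic (exists r, r < q /\ bit (val t) r /\ π1 r <> 0 /\ ~ in_stage C t r))
    as [(r & Hr & Hr')|Hno]; [eauto|].
  exists q; split; [auto|split; [auto|split]].
  - intros r Hr H1 H2; apply NNPP; intros H3; apply Hno; eauto.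
  - intros p _ Hp Ep; apply Hall; now rewrite <- Ep, pair_eta.
Qed.

(** The v that puts q into A lies below the bound in q, hence has appeared by stage s. *)
Lemma in_stage_settled St s t q :
  claim_history St -> π1 q = 0 -> setA St q -> s <= t ->
  (forall v, v < π1 (π2 q) -> graph v -> enumerated s v) -> in_stage (St t) t q.
Proof.
  intros HS Hq [t' [(_ & v & Hv & H1 & H2)|(H & _)]] Hst Hs; [|tauto].
  left; split; [auto|]; exists v; split; [auto|split; [|auto]].
  apply (enumerated_mono s); auto; apply Hs; [auto|]; eapply enumerated_graph; eauto.
Qed.

(** Each stage makes at most one claim, and [e] makes none from t0 on, so only finitely many
    failures have to be awaited. *)
Lemma claims_settled St e t0 :
  claim_history St ->
  (forall t q, t0 <= t -> fn t = e -> ~ claims t (St t) q) ->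
  (forall t q, fn t = e -> claims t (St t) q -> setA St q) ->
  exists t1, t0 <= t1 /\
    forall t q, t1 <= t -> bit (St t) ⟨e, q⟩ -> in_stage (St t) t q.
Proof.
  intros HS Ht0 HA.
  assert (HB : forall n, exists t1, t0 <= t1 /\
            forall t, t < n -> fn t = e -> forall q, claims t (St t) q ->
              in_stage (St t1) t1 q).
  { intros n; induction n as [|n (t1 & Ht1 & IH)]; [exists t0; split; [auto|lia]|].
    destruct (classic (exists q, fn n = e /\ claims n (St n) q)) as [(q & Hn & Hq)|Hno].
    - destruct (HA n q Hn Hq) as [t' Ht'].
      exists (t1 + t'); split; [lia|]; intros t Ht E r Hr.
      destruct (Nat.eq_dec t n) as [->|].
      + rewrite <- (claims_unique _ _ _ _ Hq Hr).
        apply (in_stage_mono _ t'); auto; lia.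
      + apply (in_stage_mono _ t1); auto; [lia|apply (IH t); auto; lia].
    - exists t1; split; [auto|]; intros t Ht E r Hr.
      destruct (Nat.eq_dec t n) as [->|]; [exfalso; eauto|apply (IH t); auto; lia]. }
  destruct (HB t0) as (t1 & Ht1 & H); exists t1; split; [auto|].
  intros t q Ht Hq; apply (in_stage_mono _ t1); auto.
  destruct (history_origin _ _ _ _ HS Hq) as (s & Hs & E & Hc).
  apply (H s); auto; destruct (le_lt_dec t0 s); [exfalso; eapply Ht0; eauto|auto].
Qed.

(** If [f] reduced [B] to [A], then every claim for [f] would fail, so from some
    stage on an attack could only leave its argument outside [B].  Then [D (f z)]
    contains some [⟨0, ⟨n, s⟩⟩] outside [A] with [m <= n], so the elements of
    [graph] below [m] have been enumerated by stage [s < f z]; this would make the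
    complement of [graph] c.e. *)
Lemma setB_not_c_reducible St :
  computable St -> claim_history St -> ~ le_c (setB St) (setA St).
Proof.
  intros HSt HS (f & [c Hf] & Hred).
  assert (val_f : forall t, attacks t -> fn t = encode c -> val t = f (arg t)).
  { intros t Ht E; eapply eval_functional; [apply (attacks_eval c t); auto|auto]. }
  assert (red : forall t, attacks t -> fn t = encode c ->
            (setB St (arg t) <-> forall q, bit (val t) q -> setA St q)).
  { intros t Ht E; rewrite Hred, <- val_f by auto.
    split; intros H q Hq; apply H, in_D; auto. }
  destruct (finitely_many_claims St (encode c) HS) as [t0 Ht0].
  destruct (claims_settled St (encode c) t0) as (t1 & Ht1 & Hold); auto.
  (* A claim puts the attacked argument into B, so the reduction forces the claimed number into
     A. *)
  { intros t q E Hc; destruct (claims_new _ _ _ Hc) as [Hq _].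
    pose proof Hc as (Ht & (Hbit & _) & _).
    apply (red t); auto; exists t; split; [auto|split; [auto|right]].
    exists q; split; [now apply bit_lt|auto]. }
  apply graph_not_co_ce.
  destruct (ce_proj (fun v t => t1 <= t /\ attacks t /\ fn t = encode c /\
      π1 (π2 (arg t)) = S v /\ ~ guarded t (St t) /\ ~ enumerated (val t) v))
    as [e He].
  { dec_with ltac:(first [apply dec_attacks | apply dec_guarded | apply dec_enumerated];
      comp). }
  exists e; intros v; rewrite <- He; clear e He; split.
  - intros Hv; destruct (settled (S v) t1) as (s & Hs & Hset).
    set (z := ⟨encode c, ⟨S v, s⟩⟩).
    destruct (enumeration_stage ⟨encode c, ⟨z, f z⟩⟩) as (t & H1 & H2 & Ep).
    { now apply graph_encode. }
    (* The stage t codes z, and z codes its column number s. *)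
    assert (Hst : s <= t).
    { assert (s <= z).
      { unfold z; pose proof (pair_ge (S v) s).
        pose proof (pair_ge (encode c) ⟨S v, s⟩); lia. }
      pose proof (pair_ge z (f z)); pose proof (pair_ge (encode c) ⟨z, f z⟩).
      pose proof (proj_le t); lia. }
    assert (Efn : fn t = encode c) by (rewrite Ep; now unpair).
    assert (Earg : arg t = z) by (rewrite Ep; now unpair).
    assert (Ht : attacks t).
    { split; [auto|split; [auto|]]; rewrite Earg, Efn; unfold z; now unpair. }
    exists t; split; [lia|split; [auto|split; [auto|split; [|split]]]].
    + rewrite Earg; unfold z; now unpair.
    (* A guard would put z into B and so q into A; but below row v + 1 everything has settled, and q
       would be in A already at stage t. *)
    + intros Hg; pose proof Hg as (q & _ & Hbit & Hq0 & Hq1 & Hq2).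
      apply Hq2, (in_stage_settled St s); auto.
      * apply (red t); auto; exists t; auto.
      * rewrite Earg in Hq1; unfold z in Hq1; unpair.
        intros w Hw; apply Hset; lia.
    + intros H; apply Hv; eapply enumerated_graph; eauto.
  - intros (t & Ht1t & Ht & E & Erow & Hg & Hv) Hgv.
    assert (Hnoclaim : forall q, ~ claims t (St t) q) by (intros; apply Ht0; lia).
    assert (HnB : ~ setB St (arg t)).
    (* The argument determines the function attacked and thereby its value, so no other stage can
       put it into B. *)
    { intros (s & Earg & Hs & Hwin).
      assert (Efn : fn s = fn t).
      { destruct Hs as (_ & _ & <-); destruct Ht as (_ & _ & <-); congruence. }
      assert (s = t) as ->.
      { apply attacks_unique; auto.
        rewrite <- (pair_eta (π1 s)), <- (pair_eta (π1 t)).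
        rewrite <- (pair_eta (π2 (π1 s))), <- (pair_eta (π2 (π1 t))).
        rewrite (val_f s), (val_f t), Earg, Efn by congruence; auto. }
      destruct Hwin as [H|(q & _ & H)]; [auto|eapply Hnoclaim; eauto]. }
    apply HnB, red; auto; intros q Hq; apply NNPP; intros HqA.
    assert (HqS : ~ in_stage (St t) t q) by (intros H; apply HqA; exists t; auto).
    destruct (Nat.eq_dec (π1 q) 0) as [Hq0|Hq0].
    (* For q = ⟨0, ⟨n, s⟩⟩ with v < n, v must have appeared by stage s < val t, or its later entry
       would put q into A. With n at most v, q is a guard. *)
    + destruct (le_lt_dec (S v) (π1 (π2 q))) as [Hn|Hn].
      * apply Hv, (enumerated_mono (π2 (π2 q))).
        { pose proof (bit_lt _ _ Hq); pose proof (proj_le q).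
          pose proof (proj_le (π2 q)); lia. }
        apply NNPP; intros Hnv; apply HqA.
        destruct (graph_enumerated v Hgv) as [s Hs].
        exists s; left; split; [auto|]; exists v; auto.
      * apply Hg; exists q; split; [now apply bit_lt|].
        rewrite Erow; auto.
    (* A number of the second kind would now be claimed, all former claims having failed. *)
    + destruct (claims_exist t (St t)) as [r Hr]; eauto.
      * intros r Hr; apply Hold; [auto|congruence].
      * eapply Hnoclaim; eauto.
Qed.

Theorem theorem2p11 :
  exists A : nat -> Prop,
    ce A /\ complete le_Q A /\ complete le_bd A /\ ~ complete le_c A.
Proof.
  destruct claim_history_exists as (St & HSt & HS).
  exists (setA St); split; [|split; [|split]].
  - now apply ce_setA.
  - now apply setA_Q_complete.
  - now apply setA_bd_complete.
  - intros [_ H]; exact (setB_not_c_reducible St HSt HS (H _ (ce_setB St HSt))).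
Qed.
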